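(* Let $d,n\in\mathbb{N}$, $R>0$, $\eta>0$, let $X=\{x_1,\dots,x_n\}\subseteq B_R^d$, and let $K\in\mathbb{R}^{n\times n}$ be the matrix with entries $K_{ij}=e^{-\eta\|x_i-x_j\|^2}$. Then: 1. For each $t\in\mathbb{N}$ with $t\ge(2e)^d$, $$\lambda_{t+1}(K)\le n\,\exp\Big(-\frac{d}{2e}\,t^{1/d}\,\log\frac{d\,t^{1/d}}{4e^2\eta R^2}\Big).$$ 2. For each $\tau\in(0,1]$, $$d_{\mathrm{eff}}(\tau)\le 3\Big(6+\frac{41}{d}\eta R^2+\frac{3}{d}\log\frac1\tau\Big)^d .$$
   Context: $B_R^d$ is the Euclidean ball of radius $R$ centered at the origin of $\mathbb{R}^d$. $\lambda_j(K)$ is the $j$-th largest eigenvalue of $K$ (with multiplicity), with the convention $\lambda_j(K)=0$ for $j>n$. The effective dimension of $K$ at level $\tau>0$ is $d_{\mathrm{eff}}(\tau)=\sum_{j=1}^n\frac{\lambda_j(K)}{\lambda_j(K)+\tau n}$. *)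

(* Defs.v *)
From HB Require Import structures.
From mathcomp Require Import all_boot all_order all_algebra.
From mathcomp Require Import polyrcf.
From mathcomp Require Import reals sequences exp.

Set Implicit Arguments.
Unset Strict Implicit.
Unset Printing Implicit Defensive.

Import Order.TTheory GRing.Theory Num.Theory.
Local Open Scope ring_scope.

(* The norm that the library puts on 'rV[R]_d is the sup norm, hence this
   explicit Euclidean norm. *)
Definition l2norm (R : rcfType) (d : nat) (v : 'rV[R]_d) : R :=
  Num.sqrt (\sum_(k < d) v 0 k ^+ 2).

(* The real eigenvalues of A, in decreasing order, each repeated according to
   its multiplicity as a root of the characteristic polynomial.  A real
   symmetric matrix has only real eigenvalues, so that this list then has
   size n. *)
Definition eigenvalues (R : rcfType) (n : nat) (A : 'M[R]_n) : seq R :=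
  sort >=%R
    (flatten [seq nseq (mup a (char_poly A)) a | a <- rootsR (char_poly A)]).

(* Indices start at 1: [eigval A 1] is the largest eigenvalue.  The value is 0
   past the end of the list; [eigval A 0] is meaningless. *)
Definition eigval (R : rcfType) (n : nat) (A : 'M[R]_n) (j : nat) : R :=
  nth 0 (eigenvalues A) j.-1.

Definition gaussian_kernel_matrix (R : realType) (d n : nat) (eta : R)
    (x : 'I_n -> 'rV[R]_d) : 'M[R]_n :=
  \matrix_(i < n, j < n) expR (- eta * l2norm (x i - x j) ^+ 2).

Definition effective_dim (R : rcfType) (n : nat) (A : 'M[R]_n) (tau : R) : R :=
  \sum_(1 <= j < n.+1) eigval A j / (eigval A j + tau * n%:R).

(* Main.v *)
Require Import Defs.
From HB Require Import structures.
From mathcomp Require Import all_boot all_order all_algebra.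
From mathcomp Require Import sesquilinear spectral complex polyrcf.
From mathcomp Require Import classical_sets reals topology normedtype.
From mathcomp Require Import sequences exp.
From mathcomp Require Import ring lra.

(** Write [K = T_N + E_N], where [T_N] replaces [expR (2 eta <x, y>)] by its
    Taylor polynomial of degree [< N] in
    [expR (- eta |x|^2) * expR (- eta |y|^2) * expR (2 eta <x, y>)].
    The rank of [T_N] is at most the number ['C(d + N - 1, d)] of monomials of
    degree [< N] in [d] variables.  The remainder [E_N] is a nonnegative
    combination of Hadamard powers of a Gram matrix, hence positive
    semidefinite, and its trace is at most [n (2 eta rad^2)^N / N!].  Compressing
    [K] to the kernel of [T_N] shows that the sum of the eigenvalues of [K]
    beyond the first [\rank T_N] ones is at most [\tr E_N].  With
    [B = d t^(1/d) / (2 e)], both parts follow by choosing [N] just above [B],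
    respectively just above [2 e^2 eta rad^2 + ln (1 / tau)]. *)

Set Implicit Arguments.
Unset Strict Implicit.
Unset Printing Implicit Defensive.

Import Order.TTheory GRing.Theory Num.Theory Num.Def.
Import numFieldNormedType.Exports.
Local Open Scope ring_scope.

(** * Spectral theory of real symmetric matrices and tails of their eigenvalues *)

Section SymmetricMatrices.
Local Open Scope complex_scope.
Local Open Scope sesquilinear_scope.

Definition psd (R : numDomainType) n (A : 'M[R]_n) :=
  A^T = A /\ forall v : 'rV[R]_n, 0 <= (v *m A *m v^T) 0 0.

Lemma char_poly_conjmx (F : fieldType) n (P A B : 'M[F]_n) :
  P \in unitmx -> P *m A = B *m P -> char_poly A = char_poly B.
Proof.
move=> Pu PA; rewrite /char_poly.
pose Q := map_mx polyC P.
have Qu : \det Q != 0.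
  rewrite /Q det_map_mx polyC_eq0.
  by move: Pu; rewrite unitmxE unitfE.
apply: (mulfI Qu); rewrite -[in RHS]mulrC -!det_mulmx.
congr (\det _); rewrite /char_poly_mx mulmxBr mulmxBl -!map_mxM /= PA.
by rewrite -scalar_mxC.
Qed.

Lemma map_conj_real_complex (R : rcfType) m n (A : 'M[R]_(m, n)) :
  map_mx conjC (map_mx (real_complex R) A) = map_mx (real_complex R) A.
Proof. by apply/matrixP => i j; rewrite !mxE conj_Creal ?complex_real. Qed.

(** The matrix becomes Hermitian over [R[i]], where it is unitarily diagonalizable with real
    diagonal. The factorization of the characteristic polynomial then descends to [R], because the
    embedding of polynomials is injective. *)
Lemma real_symmetric_spectral (R : rcfType) n (A : 'M[R]_n) : A^T = A ->
  exists (U : 'M[R[i]]_n) (d : 'rV[R]_n),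
    [/\ U \is unitarymx,
        U *m map_mx (real_complex R) A *m U^t* =
          diag_mx (map_mx (real_complex R) d) &
        char_poly A = \prod_(j < n) ('X - (d 0 j)%:P)].
Proof.
move=> Asym; set C := map_mx _ A.
have Cherm : C \is hermsymmx.
  apply/is_hermitianmxP; rewrite expr0 scale1r.
  by rewrite /C map_trmx Asym map_conj_real_complex.
have Creal := hermitian_spectral_diag_real Cherm.
have /hermitian_normalmx/orthomx_spectralP Ceq := Cherm.
have Uun := spectral_unitarymx C.
set U := spectralmx C in Ceq Uun.
pose d := map_mx (@complex.Re R) (spectral_diag C).
have dE : map_mx (real_complex R) d = spectral_diag C.
  apply/matrixP => i j; rewrite !mxE RRe_real //.
  exact: (mxOverP Creal).
have UC : U *m C = diag_mx (spectral_diag C) *m U.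
  by rewrite [in LHS]Ceq !mulmxA mulmxV ?mul1mx // unitarymx_unit.
exists U, d; split => //.
  by rewrite UC dE -mulmxA (unitarymxP Uun) mulmx1.
apply: (map_poly_inj (real_complex R)).
rewrite map_char_poly -/C (char_poly_conjmx (unitarymx_unit Uun) UC).
rewrite char_poly_trig; last first.
  exact: diag_mx_is_trig.
rewrite rmorph_prod /=; apply: eq_bigr => j _.
rewrite rmorphB /= map_polyX map_polyC /=.
by rewrite mxE eqxx mulr1n -dE mxE.
Qed.

Lemma unitarymx_col_norm (C : numClosedFieldType) k n (W : 'M[C]_(k, n)) j :
  W \is unitarymx -> \sum_i `|W i j| ^+ 2 <= 1.
Proof.
(* [W^t* *m W] is a Hermitian projection [Q], so [Q j j >= (Q j j) ^+ 2]. *)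
move=> /unitarymxP Wun; pose Q := W^t* *m W.
have QQ : Q *m Q = Q by rewrite /Q mulmxA -(mulmxA _ W) Wun mulmx1.
have QH : Q^t* = Q by rewrite /Q trmx_mul map_mxM /= trmxCK.
have Qjj : Q j j = \sum_i `|W i j| ^+ 2.
  by rewrite mxE; apply: eq_bigr => i _; rewrite !mxE normCK mulrC.
have Q0 : 0 <= Q j j by rewrite Qjj sumr_ge0 // => i _; rewrite exprn_ge0.
rewrite -Qjj; clearbody Q; have : Q j j ^+ 2 <= Q j j.
  rewrite -{2}QQ mxE (bigD1 j) //= expr2.
  rewrite lerDl sumr_ge0 // => i _.
  by rewrite -{1}QH !mxE mulrC -normCK exprn_ge0.
have [->|Qn0] := eqVneq (Q j j) 0; first by rewrite ler01.
by rewrite expr2 -ler_pdivlMr ?lt0r ?Qn0 // divff.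
Qed.

(** If [u_j] is the eigenvector of [d j], the weight [p j] is the squared length of the projection
    of [u_j] onto the row space of [V]. This is why it lies in [[0, 1]] and why the weights add up
    to the dimension [k]. The same [d] serves for every [V]. *)
Lemma trace_compression (R : rcfType) n (A : 'M[R]_n) : A^T = A ->
  exists2 d : 'I_n -> R,
    char_poly A = \prod_j ('X - (d j)%:P) /\ \tr A = \sum_j d j &
    forall k (V : 'M[R[i]]_(k, n)), V \is unitarymx ->
    exists p : 'I_n -> R, [/\ forall j, 0 <= p j <= 1, \sum_j p j = k%:R &
      \tr (V *m map_mx (real_complex R) A *m V^t*) = (\sum_j d j * p j)%:C].
Proof.
move=> /real_symmetric_spectral [U [d [Uun UA charA]]].
have UU : U^t* *m U = 1%:M by apply: mulmx1C; apply/unitarymxP.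
exists (fun j => d 0 j) => [|k V Vun].
  split => //; apply: complexI.
  rewrite -trace_map_mx -[map_mx _ A]mul1mx -UU -mulmxA mxtrace_mulC UA.
  rewrite mxtrace_diag.
  by rewrite rmorph_sum /=; apply: eq_bigr => j _; rewrite mxE.
pose W := V *m U^t*.
have UHun : U^t* \is unitarymx by rewrite trmxC_unitary.
have Wun : W \is unitarymx by exact: mul_unitarymx Vun UHun.
pose p j := complex.Re (\sum_i `|W i j| ^+ 2).
have pE j : (p j)%:C = \sum_i `|W i j| ^+ 2.
  by rewrite RRe_real // ger0_real // sumr_ge0 // => i _; rewrite exprn_ge0.
exists p; split.
- move=> j; apply/andP; split; rewrite -lecR pE.
    by rewrite sumr_ge0 // => i _; rewrite exprn_ge0.
  exact: unitarymx_col_norm.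
- apply: complexI; rewrite rmorph_sum /= rmorph_nat.
  under eq_bigr do rewrite pE.
  rewrite exchange_big /=.
  transitivity (\tr (W *m W^t*)); last by rewrite (unitarymxP Wun) mxtrace1.
  apply: eq_bigr => i _; rewrite mxE; apply: eq_bigr => j _.
  by rewrite !mxE normCK.
- have -> : map_mx (real_complex R) A =
    U^t* *m diag_mx (map_mx (real_complex R) d) *m U.
    by rewrite -UA !mulmxA UU mul1mx -!mulmxA UU mulmx1.
  transitivity (\tr (W *m diag_mx (map_mx (real_complex R) d) *m W^t*)).
    by rewrite /W trmx_mul map_mxM /= trmxCK !mulmxA.
  rewrite rmorph_sum /=.
  under [RHS]eq_bigr do rewrite rmorphM /= pE mulr_sumr.
  rewrite exchange_big /=; apply: eq_bigr => i _.
  rewrite mxE; apply: eq_bigr => j _.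
  by rewrite mul_mx_diag !mxE normCK mulrCA mulrA mulrC mulrA mulrC.
Qed.

Lemma psd_root_ge0 (R : realFieldType) n (A : 'M[R]_n) a :
  psd A -> root (char_poly A) a -> 0 <= a.
Proof.
move=> [_ Apos]; rewrite -eigenvalue_root_char => /eigenvalueP [v vA vn0].
have := Apos v; rewrite vA -scalemxAl mxE.
suff : 0 < (v *m v^T) 0 0 by move=> v0; rewrite pmulr_lge0.
rewrite mxE lt0r; apply/andP; split; last first.
  by apply: sumr_ge0 => i _; rewrite mxE -expr2 sqr_ge0.
apply: contraNneq vn0 => /eqP; rewrite psumr_eq0; last first.
  by move=> i _; rewrite mxE -expr2 sqr_ge0.
move=> /allP v0; apply/eqP/rowP => i; rewrite mxE.
by have := v0 i (mem_index_enum _); rewrite mxE -expr2 sqrf_eq0 => /eqP.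
Qed.

(** Both lists contain each [a] exactly [mup a (char_poly A)] times. This links the list built from
    the distinct roots with a diagonalization of [A]. *)
Lemma perm_eigenvalues (R : rcfType) n (A : 'M[R]_n) (d : 'I_n -> R) :
  char_poly A = \prod_j ('X - (d j)%:P) ->
  perm_eq (eigenvalues A) (codom d).
Proof.
move=> charA; rewrite /eigenvalues perm_sort.
apply/allP => a _ /=; apply/eqP.
have -> : count_mem a (codom d) = mup a (char_poly A).
  by rewrite charA -mu_prod_XsubC big_image.
have pn0 : char_poly A != 0 by rewrite monic_neq0 // char_poly_monic.
rewrite count_flatten -map_comp.
have -> : sumn [seq (count_mem a \o (fun b => nseq (mup b (char_poly A)) b)) i
   | i <- rootsR (char_poly A)]
   = (\sum_(b <- rootsR (char_poly A)) (b == a) * mup b (char_poly A))%N.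
  rewrite sumnE big_map; apply: eq_bigr => b _ /=.
  by rewrite count_nseq.
have uroots : uniq (rootsR (char_poly A)).
  exact: (sorted_uniq lt_trans (@lt_irreflexive _ _) (sorted_roots _ _ _)).
have [ar|anr] := boolP (a \in rootsR (char_poly A)).
  rewrite (bigD1_seq a) //= eqxx mul1n big1 ?addn0 // => b /negbTE ->.
  by rewrite mul0n.
rewrite mupNroot; last first.
  by move: anr; rewrite -roots_on_rootsR // in_itv.
rewrite big_seq big1 // => b br; case: eqP => [ba|]; last by rewrite mul0n.
by move: anr; rewrite -ba br.
Qed.

Lemma size_eigenvalues (R : rcfType) n (A : 'M[R]_n) :
  A^T = A -> size (eigenvalues A) = n.
Proof.
move=> /trace_compression [d [charA _] _].
by rewrite (perm_size (perm_eigenvalues charA)) size_codom card_ord.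
Qed.

(** A total weight of at least [n - M], with at most one unit per index, is spent most cheaply on
    the [n - M] smallest values. Applied to the weights of [trace_compression], this yields Ky Fan's
    minimum principle. *)
Lemma sum_sorted_tail_le (R : realFieldType) n (M : nat) (s : seq R)
    (d p : 'I_n -> R) :
  sorted >=%R s -> perm_eq s (codom d) ->
  (forall j, 0 <= d j) -> (forall j, 0 <= p j <= 1) ->
  n%:R <= \sum_j p j + M%:R ->
  \sum_(M <= j < n) s`_j <= \sum_j d j * p j.
Proof.
move=> s_sorted s_perm d_ge0 p01 sum_p.
have [nM|Mn] := leqP n M.
  rewrite big_geq // sumr_ge0 // => j _.
  by have /andP[p0 _] := p01 j; rewrite mulr_ge0.
have size_s : size s = n.
  by rewrite (perm_size s_perm) size_codom card_ord.
pose c := s`_M.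
have c_ge0 : 0 <= c.
  have : c \in s by rewrite mem_nth // size_s.
  by rewrite (perm_mem s_perm) => /codomP [j ->].
have anti i j : (i <= j < n)%N -> s`_j <= s`_i.
  move=> /andP[ij jn]; apply: (sorted_leq_nth ge_trans ge_refl) => //.
    by rewrite inE size_s (leq_ltn_trans ij).
  by rewrite inE size_s.
(* [min x c - c] is nonpositive and vanishes on the [M] largest entries of [s],
   so that weighting it by [p <= 1] can only increase its sum. *)
pose m x := Num.min x c - c.
have sum_m : \sum_j m (d j) = \sum_(M <= j < n) s`_j - (n - M)%:R * c.
  transitivity (\sum_(x <- s) m x).
    by rewrite (perm_big _ s_perm) big_image.
  rewrite (big_nth 0) size_s (@big_cat_nat _ _ _ M) //=; last exact: ltnW.
  rewrite big_nat_cond big1 ?add0r => [|j /andP[/andP[_ jM] _]]; last first.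
    by rewrite /m min_r ?subrr // anti // ltnW.
  rewrite mulr_natl -sumr_const_nat -sumrB; apply: eq_big_nat => j /andP[Mj jn].
  by rewrite /m min_l // anti // Mj.
have -> : \sum_(M <= j < n) s`_j = \sum_j m (d j) + (n - M)%:R * c.
  by rewrite sum_m subrK.
apply: (@le_trans _ _ (\sum_j m (d j) * p j + (\sum_j p j) * c));
  last first.
  rewrite mulr_suml -big_split /=; apply: ler_sum => j _.
  have /andP[p0 _] := p01 j.
  have : m (d j) + c <= d j by rewrite /m subrK ge_min lexx.
  by move=> mdc; rewrite [p j * c]mulrC -mulrDl ler_wpM2r.
apply: lerD.
  apply: ler_sum => j _; have /andP[p0 p1] := p01 j.
  have : m (d j) <= 0 by rewrite /m subr_le0 ge_min lexx orbT.
  by move=> m0; rewrite ler_niMr.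
by rewrite ler_wpM2r // natrB 1?ltnW // lerBlDr.
Qed.

(** On the left kernel of [L] the matrices [A] and [E] have the same compression. Its trace is at
    least the tail sum for [A], the kernel having dimension at least [n - M], and at most [\tr E],
    the weights being at most 1 and the eigenvalues of [E] nonnegative. *)
Lemma sum_eigenvalues_tail_le_trace (R : rcfType) n (A L E : 'M[R]_n) (M : nat) :
  A = L + E -> psd A -> psd E -> (\rank L <= M)%N ->
  \sum_(M <= j < n) (eigenvalues A)`_j <= \tr E.
Proof.
move=> AE Apsd Epsd rkL.
have [d [charA _] compA] := trace_compression (proj1 Apsd).
have [e [charE trE] compE] := trace_compression (proj1 Epsd).
have root_prod (f : 'I_n -> R) j : root (\prod_j ('X - (f j)%:P)) (f j).
  by rewrite (bigD1 j) //= rootM root_XsubC eqxx.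
have d_ge0 j : 0 <= d j by apply: (psd_root_ge0 Apsd); rewrite charA.
have e_ge0 j : 0 <= e j by apply: (psd_root_ge0 Epsd); rewrite charE.
pose LC := map_mx (real_complex R) L.
(* Gram-Schmidt turns a basis of the left kernel into the orthonormal rows of [V]. *)
pose B := row_base (kermx LC).
pose V := schmidt B.
have Vun : V \is unitarymx by apply: schmidt_unitarymx; rewrite rank_leq_row.
have VL : V *m LC = 0.
  apply/sub_kermxP; rewrite (eqmx_schmidt_free (row_base_free _)).
  by rewrite eq_row_base.
have [p [p01 sum_p trA]] := compA _ _ Vun.
have [q [q01 _ trVE]] := compE _ _ Vun.
have eq_tr : \sum_j d j * p j = \sum_j e j * q j.
  by apply: complexI; rewrite -trA -trVE AE map_mxD mulmxDr VL add0r.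
apply: (@le_trans _ _ (\sum_j d j * p j)).
  apply: sum_sorted_tail_le => //.
  - by apply: sort_sorted => x y; rewrite /= le_total.
  - exact: perm_eigenvalues.
  - rewrite sum_p -natrD ler_nat mxrank_ker mxrank_map.
    by rewrite -[X in (X <= _)%N](subnK (rank_leq_row L)) leq_add2l.
rewrite eq_tr trE; apply: ler_sum => j _.
by have /andP[_ q1] := q01 j; rewrite ler_piMr.
Qed.

End SymmetricMatrices.


(** * Taylor polynomials of the exponential, applied to Gram matrices *)

Lemma series_exp_coeff_le_expR (R : realType) (u : R) N :
  0 <= u -> \sum_(0 <= m < N) u ^+ m / m`!%:R <= expR u.
Proof.
move=> u0; apply: (nondecreasing_cvgn_le _ (is_cvg_series_exp_coeff u) N).
apply/nondecreasing_seqP => i; rewrite /series /= big_nat_recr //= lerDl.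
exact: exp_coeff_ge0.
Qed.

(** The tail is bounded term by term: [m! k! <= (m + k)!] gives [u^(m+k) / (m+k)! <= (u^k / k!) (u^m
    / m!)], and the second factors sum to at most [expR u]. *)
Lemma expR_taylor_le (R : realType) (u : R) k : 0 <= u ->
  expR u - \sum_(0 <= m < k) u ^+ m / m`!%:R <= u ^+ k / k`!%:R * expR u.
Proof.
move=> u0; rewrite lerBlDl; apply: limr_le.
  exact: is_cvg_series_exp_coeff.
near=> N; rewrite /series /exp_coeff /=.
have kN : (k <= N)%N by near: N; exact: nbhs_infty_ge.
rewrite (@big_cat_nat _ _ _ k) //= lerD2l.
rewrite -{1}[k]add0n big_addn.
apply: le_trans (ler_wpM2l _ (series_exp_coeff_le_expR (N - k) u0)); last first.
  by rewrite divr_ge0 // exprn_ge0.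
rewrite mulr_sumr; apply: ler_sum => m _.
rewrite mulf_div -exprD [(k + m)%N]addnC ler_wpM2l ?exprn_ge0 //.
rewrite -natrM lef_pV2 ?posrE ?ltr0n ?muln_gt0 ?fact_gt0 // ler_nat.
rewrite -(bin_fact (leq_addl m k)) addnK.
by rewrite leq_pmull // bin_gt0 leq_addl.
Unshelve. all: by end_near. Qed.

(** Hadamard powers of a Gram matrix are positive semidefinite: expanding one factor of the inner
    product over the coordinates [k] replaces the weights [w i] by [w i * x i 0 k] and lowers the
    power. At power 0 the form is the square of the sum of the weights. *)
Lemma gram_power_ge0 (R : realFieldType) n d (x : 'I_n -> 'rV[R]_d)
    (w : 'I_n -> R) m :
  0 <= \sum_i \sum_j w i * w j * (\sum_k x i 0 k * x j 0 k) ^+ m.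
Proof.
elim: m w => [|m IHm] w.
  under eq_bigr do under eq_bigr do rewrite expr0 mulr1.
  under eq_bigr do rewrite -mulr_sumr.
  by rewrite -mulr_suml -expr2 sqr_ge0.
have -> : \sum_i \sum_j w i * w j * (\sum_k x i 0 k * x j 0 k) ^+ m.+1 =
   \sum_k \sum_i \sum_j (w i * x i 0 k) * (w j * x j 0 k) *
     (\sum_k x i 0 k * x j 0 k) ^+ m.
  rewrite [RHS]exchange_big; apply: eq_bigr => i _.
  rewrite [RHS]exchange_big; apply: eq_bigr => j _.
  rewrite exprS mulr_suml mulr_sumr; apply: eq_bigr => k _.
  ring.
by apply: sumr_ge0 => k _; exact: IHm.
Qed.

(** Adding the Taylor term of degree [N] changes the quadratic form by [c^N / N!] times a form that
    is nonnegative by [gram_power_ge0]. The partial sums therefore increase to their limit. *)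
Lemma gram_expR_taylor_le (R : realType) n d (x : 'I_n -> 'rV[R]_d) (w : 'I_n -> R)
    (c : R) k : 0 <= c ->
  \sum_i \sum_j w i * w j *
    (\sum_(0 <= m < k) (c * \sum_l x i 0 l * x j 0 l) ^+ m / m`!%:R) <=
  \sum_i \sum_j w i * w j * expR (c * \sum_l x i 0 l * x j 0 l).
Proof.
move=> c0.
pose Q N := \sum_i \sum_j w i * w j *
    (\sum_(0 <= m < N) (c * \sum_l x i 0 l * x j 0 l) ^+ m / m`!%:R).
have Qcvg : (Q @ \oo -->
    \sum_i \sum_j w i * w j * expR (c * \sum_l x i 0 l * x j 0 l))%classic.
  apply: cvg_big => [|i _]; first exact: add_continuous.
  apply: cvg_big => [|j _]; first exact: add_continuous.
  by apply: cvgMl_tmp; exact: is_cvg_series_exp_coeff.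
rewrite -(cvg_lim (@Rhausdorff R) Qcvg).
apply: (@nondecreasing_cvgn_le _ Q _ _ k); last first.
  by apply/cvg_ex; eexists; exact: Qcvg.
apply/nondecreasing_seqP => N; rewrite -subr_ge0 /Q -sumrB.
under eq_bigr do rewrite -sumrB.
have -> : \sum_i \sum_j (w i * w j *
      \sum_(0 <= m < N.+1) (c * \sum_l x i 0 l * x j 0 l) ^+ m / m`!%:R -
    w i * w j *
      \sum_(0 <= m < N) (c * \sum_l x i 0 l * x j 0 l) ^+ m / m`!%:R) =
   c ^+ N / N`!%:R * \sum_i \sum_j w i * w j * (\sum_l x i 0 l * x j 0 l) ^+ N.
  rewrite mulr_sumr; apply: eq_bigr => i _.
  rewrite mulr_sumr; apply: eq_bigr => j _.
  rewrite big_nat_recr //= -mulrBr addrAC subrr add0r exprMn.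
  ring.
by rewrite mulr_ge0 ?gram_power_ge0 // divr_ge0 // exprn_ge0.
Qed.

(** Every column is a combination of the vectors of values, at the points [x i], of the monomials of
    degree at most [N], scaled by [h]. There are ['C(d + N, d)] such monomials. *)
Lemma rank_power_gram (R : fieldType) n d N (x : 'I_n -> 'rV[R]_d)
    (c : nat -> R) (h : 'I_n -> R) :
  (\rank (\matrix_(i, j) (h i * h j * \sum_(0 <= m < N.+1)
      c m * (\sum_l x i 0 l * x j 0 l) ^+ m))%R <= 'C(d + N, d))%N.
Proof.
(* [S] is the set of exponent vectors of total degree at most [N]; no single exponent then exceeds
   [N], so that ['I_N.+1] can hold it. *)
pose S := [set t : d.-tuple 'I_N.+1 | (\sum_(i <- t) i <= N)%N].
rewrite -card_partial_ord_partitions -/S.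
pose mono (b : 'I_d -> nat) (i : 'I_n) := \prod_l x i 0 l ^+ b l.
pose V : 'M[R]_(#|S|, n) := \matrix_(a < #|S|, i < n)
  (h i * mono (fun l => nat_of_ord (tnth (enum_val a) l)) i).
(* The extra monomial [b] makes the induction on [m] work: expanding one factor of the inner product
   raises one exponent of [b] and keeps the total degree. *)
have monoV (y : 'rV_d) m (b : 'I_d -> nat) : (\sum_l b l + m <= N)%N ->
  ((\row_i (h i * mono b i * (\sum_l x i 0 l * y 0 l) ^+ m))%R <= V)%MS.
  elim: m b => [|m IHm] b bN.
    rewrite addn0 in bN.
    pose t := [tuple inord (b l) | l < d] : d.-tuple 'I_N.+1.
    have tE l : tnth t l = b l :> nat.
      rewrite tnth_mktuple inordK // ltnS (leq_trans _ bN) //.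
      by rewrite (bigD1 l) //= leq_addr.
    have tS : t \in S.
      rewrite inE big_tuple.
      by under eq_bigr do rewrite tE.
    apply: (eq_row_sub (enum_rank_in tS t)); apply/rowP => i.
    rewrite !mxE enum_rankK_in // expr0 mulr1; congr (_ * _).
    by apply: eq_bigr => l _; rewrite tE.
  have -> : \row_i (h i * mono b i * (\sum_l x i 0 l * y 0 l) ^+ m.+1) =
    \sum_l y 0 l *: \row_i (h i * mono (fun l' => b l' + (l' == l))%N i *
      (\sum_l x i 0 l * y 0 l) ^+ m).
    apply/rowP => i; rewrite summxE !mxE exprS mulr_suml mulr_sumr.
    apply: eq_bigr => l _; rewrite !mxE.
    have -> : mono (fun l' => b l' + (l' == l))%N i = mono b i * x i 0 l.
      rewrite /mono; under eq_bigr do rewrite exprD.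
      rewrite big_split /=; congr (_ * _).
      rewrite (bigD1 l) //= eqxx expr1 big1 ?mulr1 // => l' /negbTE ->.
      by rewrite expr0.
    ring.
  apply: summx_sub => l _; apply: scalemx_sub; apply: IHm.
  rewrite big_split /= -addnA.
  have -> : (\sum_(i < d) (i == l) = 1)%N.
    by rewrite (bigD1 l) //= eqxx big1 // => l' /negbTE ->.
  by rewrite add1n.
apply: leq_trans (rank_leq_row V); rewrite -mxrank_tr; apply: mxrankS.
apply/row_subP => j.
set r := row _ _.
have mono0 i : mono (fun=> 0%N) i = 1 by rewrite /mono big1.
have -> : r = \sum_(0 <= m < N.+1) (h j * c m) *:
   \row_i (h i * mono (fun=> 0%N) i * (\sum_l x i 0 l * x j 0 l) ^+ m).
  apply/rowP => i; rewrite summxE !mxE mulr_sumr; apply: eq_bigr => m _.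
  rewrite !mxE mono0; ring.
rewrite big_mkord; apply: summx_sub => m _; apply: scalemx_sub; apply: monoV.
by rewrite big1 // add0n -ltnS.
Qed.


(** * Splitting the Gaussian kernel matrix into Taylor part and remainder *)

Definition gaussian_taylor (R : realType) (d n : nat) (eta : R)
    (x : 'I_n -> 'rV[R]_d) (N : nat) : 'M[R]_n :=
  \matrix_(i, j) (expR (- eta * l2norm (x i) ^+ 2) *
    expR (- eta * l2norm (x j) ^+ 2) *
    \sum_(0 <= m < N) (2 * eta) ^+ m / m`!%:R *
      (\sum_l x i 0 l * x j 0 l) ^+ m).

Lemma sqr_l2norm (R : rcfType) d (v : 'rV[R]_d) :
  l2norm v ^+ 2 = \sum_l v 0 l * v 0 l.
Proof.
rewrite /l2norm sqr_sqrtr; first by apply: eq_bigr => l _; rewrite expr2.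
by apply: sumr_ge0 => l _; rewrite sqr_ge0.
Qed.

Lemma gaussian_kernel_matrixE (R : realType) (d n : nat) (eta : R)
    (x : 'I_n -> 'rV[R]_d) i j :
  gaussian_kernel_matrix eta x i j =
  expR (- eta * l2norm (x i) ^+ 2) * expR (- eta * l2norm (x j) ^+ 2) *
  expR (2 * eta * \sum_l x i 0 l * x j 0 l).
Proof.
rewrite mxE -!expRD; congr expR; rewrite !sqr_l2norm.
rewrite !mulr_sumr -!big_split /=; apply: eq_bigr => l _.
rewrite !mxE; ring.
Qed.

Lemma rank_gaussian_taylor (R : realType) (d n : nat) (eta : R)
    (x : 'I_n -> 'rV[R]_d) N :
  (\rank (gaussian_taylor eta x N.+1) <= 'C(d + N, d))%N.
Proof. exact: rank_power_gram. Qed.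

Lemma psd_gaussian_remainder (R : realType) (d n : nat) (eta : R)
    (x : 'I_n -> 'rV[R]_d) N : 0 <= eta ->
  psd (gaussian_kernel_matrix eta x - gaussian_taylor eta x N).
Proof.
move=> eta0; split.
  apply/matrixP => i j; rewrite mxE [LHS]mxE [RHS]mxE; congr (_ + _).
    rewrite !gaussian_kernel_matrixE [X in _ = X * _]mulrC.
    by congr (_ * expR (_ * _)); apply: eq_bigr => l _; rewrite mulrC.
  rewrite !mxE [X in _ = - (X * _)]mulrC; congr (- (_ * _)).
  apply: eq_bigr => m _; congr (_ * _ ^+ m).
  by apply: eq_bigr => l _; rewrite mulrC.
move=> v.
(* The Gaussian prefactors are absorbed into the vector, which leaves the form of
   [gram_expR_taylor_le]. *)
pose w i := v 0 i * expR (- eta * l2norm (x i) ^+ 2).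
have c0 : 0 <= 2 * eta by rewrite mulr_ge0.
have := gram_expR_taylor_le x w N c0; rewrite -subr_ge0 => /le_trans; apply.
rewrite le_eqVlt; apply/orP; left; apply/eqP.
rewrite mxE [X in X - _]exchange_big [X in _ - X]exchange_big -sumrB.
apply: eq_bigr => j _ /=.
rewrite mxE mulr_suml -sumrB; apply: eq_bigr => i _.
rewrite mxE [X in _ = v 0 i * (X + _) * _]gaussian_kernel_matrixE !mxE /w.
set S := \sum_(0 <= m < N) _; set S' := \sum_(0 <= m < N) _.
have -> : S' = S.
  apply: eq_bigr => m _; rewrite [(2 * eta * _) ^+ m]exprMn; ring.
ring.
Qed.

(** With [u = 2 eta |x_i|^2], a diagonal entry is [expR (- u)] times the Taylor remainder of
    [expR u]. The factor [expR u] in [expR_taylor_le] cancels this prefactor, so no exponential of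
    the radius survives. *)
Lemma trace_gaussian_remainder_le (R : realType) (d n : nat) (rad eta : R)
    (x : 'I_n -> 'rV[R]_d) N : 0 <= eta ->
  (forall i, l2norm (x i) <= rad) ->
  \tr (gaussian_kernel_matrix eta x - gaussian_taylor eta x N) <=
  n%:R * ((2 * eta * rad ^+ 2) ^+ N / N`!%:R).
Proof.
move=> eta0 xr.
rewrite mulr_natl -[n in X in _ <= X]card_ord -sumr_const; apply: ler_sum => i _.
rewrite mxE gaussian_kernel_matrixE !mxE -sqr_l2norm -mulrBr.
set r := l2norm (x i).
have r0 : 0 <= r by rewrite sqrtr_ge0.
have r2 : r ^+ 2 <= rad ^+ 2 by rewrite lerXn2r ?nnegrE ?(le_trans r0) ?xr.
pose u := 2 * eta * r ^+ 2.
have u0 : 0 <= u by rewrite !mulr_ge0 ?sqr_ge0.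
apply: (@le_trans _ _ (u ^+ N / N`!%:R)); last first.
  apply: ler_wpM2r; first by rewrite invr_ge0.
  apply: lerXn2r; rewrite ?nnegrE //.
    by rewrite mulr_ge0 ?sqr_ge0 // mulr_ge0.
  by rewrite ler_wpM2l // mulr_ge0.
have -> : expR (- eta * r ^+ 2) * expR (- eta * r ^+ 2) = expR (- u).
  by rewrite -expRD /u; congr expR; ring.
have -> : \sum_(0 <= m < N) (2 * eta) ^+ m / m`!%:R * (r ^+ 2) ^+ m =
   \sum_(0 <= m < N) u ^+ m / m`!%:R.
  by apply: eq_bigr => m _; rewrite /u [(2 * eta * _) ^+ m]exprMn; ring.
rewrite -/u.
apply: (@le_trans _ _ (expR (- u) * (u ^+ N / N`!%:R * expR u))).
  by rewrite ler_wpM2l ?expR_ge0 // expR_taylor_le.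
by rewrite mulrCA [expR (- u) * _]mulrC expRxMexpNx_1 mulr1.
Qed.

Lemma psd_gaussian_kernel_matrix (R : realType) (d n : nat) (eta : R)
    (x : 'I_n -> 'rV[R]_d) : 0 <= eta -> psd (gaussian_kernel_matrix eta x).
Proof.
(* With no Taylor term kept, the remainder is the kernel matrix itself. *)
move=> eta0; have := psd_gaussian_remainder x 0 eta0.
congr psd; apply/matrixP => i j.
by rewrite !mxE big_geq // mulr0 subr0.
Qed.

Lemma psd_eigenvalues_ge0 (R : rcfType) n (A : 'M[R]_n) j :
  psd A -> 0 <= (eigenvalues A)`_j.
Proof.
move=> Apsd; have [jn|nj] := ltnP j (size (eigenvalues A)); last first.
  by rewrite nth_default.
apply: (psd_root_ge0 Apsd).
have := mem_nth 0 jn; rewrite mem_sort => /flattenP [s /mapP [a ar ->]].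
rewrite mem_nseq => /andP[_ /eqP ->].
by move: ar; rewrite -roots_on_rootsR ?monic_neq0 ?char_poly_monic // => /andP[].
Qed.

Lemma sum_gaussian_eigenvalues_tail_le (R : realType) (d n : nat) (rad eta : R)
    (x : 'I_n -> 'rV[R]_d) N M : 0 <= eta ->
  (forall i, l2norm (x i) <= rad) -> ('C(d + N, d) <= M)%N ->
  \sum_(M <= j < n) (eigenvalues (gaussian_kernel_matrix eta x))`_j <=
  n%:R * ((2 * eta * rad ^+ 2) ^+ N.+1 / N.+1`!%:R).
Proof.
move=> eta0 xr NM.
apply: le_trans (trace_gaussian_remainder_le N.+1 eta0 xr).
apply: (@sum_eigenvalues_tail_le_trace _ _ _ (gaussian_taylor eta x N.+1)).
- by rewrite addrC subrK.
- exact: psd_gaussian_kernel_matrix.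
- exact: psd_gaussian_remainder.
- exact: leq_trans (rank_gaussian_taylor _ _ _) NM.
Qed.

(** This is the case of an empty Taylor part, which has rank 0 and leaves the trace of the whole
    kernel matrix. *)
Lemma sum_gaussian_eigenvalues_le (R : realType) (d n : nat) (rad eta : R)
    (x : 'I_n -> 'rV[R]_d) : 0 <= eta -> (forall i, l2norm (x i) <= rad) ->
  \sum_(0 <= j < n) (eigenvalues (gaussian_kernel_matrix eta x))`_j <= n%:R.
Proof.
move=> eta0 xr.
have := trace_gaussian_remainder_le 0 eta0 xr.
rewrite expr0 divr1 mulr1; apply: le_trans.
have T0 : gaussian_taylor eta x 0 = 0.
  by apply/matrixP => i j; rewrite !mxE big_geq // mulr0.
apply: (@sum_eigenvalues_tail_le_trace _ _ _ (gaussian_taylor eta x 0)).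
- by rewrite addrC subrK.
- exact: psd_gaussian_kernel_matrix.
- exact: psd_gaussian_remainder.
- by rewrite T0 mxrank0.
Qed.

(** * Estimates for factorials, binomials and [e] *)

Lemma exprn_le_fact_expR (R : realType) k : k%:R ^+ k <= k`!%:R * expR 1 ^+ k :> R.
Proof.
(* Since [expR 1 ^+ k] is [expR k%:R], it suffices that the single term [k^k / k!] of the
   exponential series at [k] is at most the sum. *)
rewrite -expRM_natl mulr1 mulrC -ler_pdivrMr ?ltr0n ?fact_gt0 //.
case: k => [|k]; first by rewrite expr0 divr1 expR0.
by apply: le_trans (expR_ge1Dxn k (ler0n _ _)); rewrite lerDr.
Qed.

Lemma exprn_div_fact_le (R : realType) (u : R) k : 0 <= u -> (0 < k)%N ->
  u ^+ k / k`!%:R <= (expR 1 * u / k%:R) ^+ k.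
Proof.
move=> u0 k0; rewrite ler_pdivrMr ?ltr0n ?fact_gt0 //.
rewrite expr_div_n mulrAC ler_pdivlMr ?exprn_gt0 ?ltr0n //.
rewrite exprMn mulrAC mulrC ler_wpM2r ?exprn_ge0 // mulrC.
exact: exprn_le_fact_expR.
Qed.

Lemma bin_le_expR (R : realType) N d : (0 < d)%N ->
  'C(N, d)%:R <= (expR 1 * N%:R / d%:R) ^+ d :> R.
Proof.
move=> d0; apply: le_trans (exprn_div_fact_le (ler0n _ N) d0).
rewrite ler_pdivlMr ?ltr0n ?fact_gt0 // -natrM bin_ffact -natrX ler_nat.
rewrite ffact_prod -[in leqRHS](card_ord d) -prod_nat_const.
by apply: leq_prod => i _; exact: leq_subr.
Qed.

(** Five Taylor terms give [e - 65/24 <= e/120], that is [e <= 325/119]. This is precise enough for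
    [2 e^3 <= 41], the source of the constant 41. *)
Lemma expR1_bound (R : realType) : expR 1 <= 2732 / 1000 :> R.
Proof.
have := expR_taylor_le 5 (@ler01 R).
rewrite !big_nat_recr //= big_geq // !expr1n !factS fact0.
rewrite !mulnE /= => H; lra.
Qed.

Lemma expR1_ge2 (R : realType) : 2 <= expR 1 :> R.
Proof. by have := expR_ge1Dx (1 : R); rewrite -natr1. Qed.


(** The left side is at most [(e u / k)^k], and [s ln (s / (e u))] has derivative [ln (s / u)], so
    it increases for [s >= u]; hence its value at [k] is at least that at [B]. *)
Lemma exprn_div_fact_le_expR (R : realType) (u B : R) k :
  0 < u -> u <= B -> B <= k%:R ->
  u ^+ k / k`!%:R <= expR (- B * ln (B / (expR 1 * u))).
Proof.
move=> u0 uB Bk.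
have B0 : 0 < B := lt_le_trans u0 uB.
have K0 : 0 < k%:R :> R := lt_le_trans B0 Bk.
have k0 : (0 < k)%N by rewrite -(ltr0n R).
have e0 : 0 < expR 1 :> R := expR_gt0 1.
apply: le_trans (exprn_div_fact_le (ltW u0) k0) _.
have q0 : 0 < expR 1 * u / k%:R by rewrite divr_gt0 ?mulr_gt0.
rewrite -(lnK q0) -expRM_natl ler_expR.
rewrite !ln_div ?posrE ?mulr_gt0 // !lnM ?posrE // expRK.
have lnkB : 1 - B / k%:R <= ln k%:R - ln B.
  rewrite -lerN2 !opprB -ln_div ?posrE //.
  have := @le_ln1Dx R (B / k%:R - 1).
  rewrite [1 + _]addrC subrK; apply.
  by rewrite ltrBrDl subrr divr_gt0.
have lnuB : ln u <= ln B by rewrite ler_ln ?posrE.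
have : k%:R - B <= k%:R * (ln k%:R - ln B).
  have -> : k%:R - B = k%:R * (1 - B / k%:R) by field; rewrite gt_eqF.
  by rewrite ler_wpM2l // ltW.
(* The gap between the exponents is [k (ln k - ln B) - (k - B) + (k - B) (ln B - ln u)]. *)
nra.
Qed.

(** * Eigenvalue decay and effective dimension *)

Lemma exists_nat_floor (R : realType) (y : R) : 0 <= y ->
  exists m : nat, m%:R <= y < m.+1%:R.
Proof. by move=> y0; exists (Num.truncn y); rewrite truncn_itv. Qed.

Lemma gaussian_eigval_le (R : realType) (d n : nat) (rad eta : R)
    (x : 'I_n -> 'rV[R]_d) (t : nat) :
  (0 < d)%N -> 0 < rad -> 0 < eta -> (forall i, l2norm (x i) <= rad) ->
  (2 * expR 1) ^+ d <= t%:R :> R ->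
  eigval (gaussian_kernel_matrix eta x) t.+1 <=
    n%:R * expR (- (d%:R / (2 * expR 1)) * (t%:R `^ (d%:R^-1)) *
                 ln (d%:R * (t%:R `^ (d%:R^-1)) /
                     (4 * expR 1 ^+ 2 * eta * rad ^+ 2))).
Proof.
move=> d0 rad0 eta0 xr tge; set A := gaussian_kernel_matrix eta x.
have D0 : 0 < d%:R :> R by rewrite ltr0n.
have e0 : 0 < expR 1 :> R := expR_gt0 1.
set s := t%:R `^ (d%:R^-1).
have s0 : 0 <= s by apply: powR_ge0.
have sd : s ^+ d = t%:R.
  by rewrite -powR_mulrn // /s -powRrM mulVf ?gt_eqF // powRr1.
have s2e : 2 * expR 1 <= s.
  rewrite -(@ler_pXn2r _ d) ?nnegrE ?sd //; first by rewrite mulr_ge0 // ltW.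
(* [B] solves [(2 e B / d)^d = t]. The assumption on [t] amounts to [d <= B], so every [m <= B]
   satisfies [e (d + m) / d <= 2 e B / d], and the rank bound ['C(d + m, d)] is at most [t]. *)
pose B := d%:R * s / (2 * expR 1).
have dB : d%:R <= B by rewrite ler_pdivlMr ?mulr_gt0 // ler_wpM2l // ltW.
have B0 : 0 < B := lt_le_trans D0 dB.
pose u := 2 * eta * rad ^+ 2.
have u0 : 0 < u by rewrite mulr_gt0 ?exprn_gt0 // mulr_gt0.
have -> : - (d%:R / (2 * expR 1)) * s *
   ln (d%:R * s / (4 * expR 1 ^+ 2 * eta * rad ^+ 2))
   = - B * ln (B / (expR 1 * u)).
  congr (_ * ln _); rewrite /B /u; field; first by rewrite gt_eqF.
  by rewrite !gt_eqF.
have Apsd : psd A by apply: psd_gaussian_kernel_matrix; exact: ltW.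
rewrite /eigval /=.
(* Eigenvalue number [t + 1] is entry [t] of the list; for [t >= n] it is the default value 0. *)
have [tn|nt] := ltnP t n; last first.
  by rewrite nth_default ?(size_eigenvalues (proj1 Apsd)) // mulr_ge0 ?expR_ge0.
have tail M : (M <= t)%N ->
  (eigenvalues A)`_t <= \sum_(M <= j < n) (eigenvalues A)`_j.
  move=> Mt; rewrite (@big_cat_nat _ _ _ t) //=; last exact: ltnW.
  rewrite [X in _ <= _ + X]big_ltn // addrCA lerDl addr_ge0 // sumr_ge0 // => j _;
    exact: psd_eigenvalues_ge0.
(* If [B < u], the logarithm is nonpositive and the claimed bound is at least [n], which already
   bounds the sum of all eigenvalues. *)
have [uB|Bu] := lerP u B; last first.
  apply: le_trans (tail 0%N (leq0n _)) _.
  apply: le_trans (sum_gaussian_eigenvalues_le (ltW eta0) xr) _.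
  rewrite ler_peMr // -[leLHS]expR0 ler_expR mulNr oppr_ge0 pmulr_rle0 // ln_le0 //.
  rewrite ler_pdivrMr ?mulr_gt0 // mul1r (le_trans (ltW Bu)) //.
  by rewrite ler_peMl ?(ltW u0) // (le_trans _ (expR1_ge2 R)) // ler1n.
(* The floor meets both demands: [m <= B] for the rank, and [B < m + 1] for the remainder, whose
   exponent is [m + 1]. *)
have [m /andP[mB Bm]] := exists_nat_floor (ltW B0).
have rkt : ('C(d + m, d) <= t)%N.
  rewrite -(ler_nat R); apply: le_trans (bin_le_expR R (d + m) d0) _.
  rewrite -sd lerXn2r ?nnegrE //.
    by rewrite divr_ge0 // mulr_ge0 // ltW.
  rewrite ler_pdivrMr // natrD.
  have -> : s * d%:R = expR 1 * (2 * B) by rewrite /B; field; rewrite gt_eqF.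
  by rewrite ler_wpM2l ?(ltW e0) //; lra.
apply: le_trans (tail _ rkt) _.
have := sum_gaussian_eigenvalues_tail_le (N := m) (ltW eta0) xr (leqnn _).
move=> /le_trans; apply.
by rewrite ler_wpM2l // exprn_div_fact_le_expR // ltW.
Qed.

(** The first ['C(d + m, d)] summands are at most 1 each. In the others the denominator is at least
    [tau * n], and [m] is taken so large that together they contribute at most 1. *)
Lemma gaussian_effective_dim_le (R : realType) (d n : nat) (rad eta tau : R)
    (x : 'I_n -> 'rV[R]_d) :
  (0 < d)%N -> 0 < rad -> 0 < eta -> (forall i, l2norm (x i) <= rad) ->
  0 < tau <= 1 ->
  effective_dim (gaussian_kernel_matrix eta x) tau <=
    3 * (6 + 41 / d%:R * eta * rad ^+ 2 + 3 / d%:R * ln (1 / tau)) ^+ d.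
Proof.
move=> d0 rad0 eta0 xr /andP[tau0 tau1]; set A := gaussian_kernel_matrix eta x.
have D0 : 0 < d%:R :> R by rewrite ltr0n.
have e0 : 0 < expR 1 :> R := expR_gt0 1.
have e_le := expR1_bound R.
have e_ge := expR1_ge2 R.
set e := expR 1 in e0 e_le e_ge.
pose a := eta * rad ^+ 2.
have a0 : 0 < a by rewrite mulr_gt0 // exprn_gt0.
set l := ln (1 / tau).
have l0 : 0 <= l by rewrite ln_ge0 // ler_pdivlMr // mul1r.
(* For [m + 1 > y] and [u = 2 a], the first summand of [y] forces [e u / (m + 1) <= 1 / e], and the
   second forces [expR (- (m + 1)) <= tau]. *)
pose y := 2 * e ^+ 2 * a + l.
have y0 : 0 < y by rewrite ltr_wpDr // !mulr_gt0 // exprn_gt0.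
have [m /andP[my ym]] := exists_nat_floor (ltW y0).
have Apsd : psd A by apply: psd_gaussian_kernel_matrix; exact: ltW.
set Z := 6 + _ + _.
have ZE : Z = 6 + (41 * a + 3 * l) / d%:R.
  by rewrite /Z /a; field; rewrite gt_eqF.
have Z1 : 1 <= Z.
  rewrite ZE; apply: (@le_trans _ _ 6); first by rewrite ler1n.
  by rewrite lerDl divr_ge0 // addr_ge0 // mulr_ge0 // ltW.
have binZ : 'C(d + m, d)%:R <= Z ^+ d.
  apply: le_trans (bin_le_expR R (d + m) d0) _; rewrite -/e.
  rewrite lerXn2r ?nnegrE //.
  - by rewrite divr_ge0 // mulr_ge0 // ltW.
  - exact: le_trans Z1.
  (* As [m <= y], one has [e (d + m) <= e d + 2 e^3 a + e l], to be compared with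
     [Z d = 6 d + 41 a + 3 l] coefficient by coefficient. *)
  rewrite ler_pdivrMr // ZE mulrDl mulfVK ?gt_eqF // natrD.
  have em : e * m%:R <= e * y by rewrite ler_wpM2l // ltW.
  have e3 : 2 * e ^+ 3 <= 41.
    have : e ^+ 3 <= (2732 / 1000) ^+ 3
      by rewrite lerXn2r ?nnegrE // ?divr_ge0 // ltW.
    by move=> ?; lra.
  have ey : e * y <= 41 * a + 3 * l.
    have -> : e * y = 2 * e ^+ 3 * a + e * l by rewrite /y; ring.
    apply: lerD; first by rewrite ler_wpM2r // ltW.
    rewrite ler_wpM2r //; lra.
  have ed : e * d%:R <= 6 * d%:R by rewrite ler_wpM2r // ?(ltW D0) //; lra.
  by rewrite mulrDr; lra.
have tail_tau : (2 * eta * rad ^+ 2) ^+ m.+1 / m.+1`!%:R <= tau.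
  have u0 : 0 <= 2 * eta * rad ^+ 2 by rewrite mulr_ge0 ?sqr_ge0 // mulr_ge0 // ltW.
  apply: le_trans (exprn_div_fact_le u0 _) _ => //; rewrite -/e.
  apply: (@le_trans _ _ (expR (- 1) ^+ m.+1)).
    rewrite lerXn2r ?nnegrE ?expR_ge0 //.
      by rewrite divr_ge0 // mulr_ge0 // ltW.
    rewrite ler_pdivrMr ?ltr0n // expRN -/e ler_pdivlMl //.
    apply: le_trans (ltW ym).
    have -> : e * (e * (2 * eta * rad ^+ 2)) = 2 * e ^+ 2 * a by rewrite /a; ring.
    by rewrite lerDl.
  rewrite -expRM_natl -[leRHS]lnK ?posrE // ler_expR mulrN1.
  have -> : ln tau = - l by rewrite /l div1r lnV ?posrE // opprK.
  rewrite lerN2; apply: le_trans (ltW ym).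
  by rewrite lerDr mulr_ge0 // ?(ltW a0) // mulr_ge0 // exprn_ge0 // ltW.
rewrite /effective_dim big_add1 /=.
(* For [n = 0] the sum is empty; otherwise [tau * n] is a positive denominator. *)
have [n0|n0] := posnP n.
  by rewrite big_geq ?n0 // mulr_ge0 // exprn_ge0 // (le_trans _ Z1).
have tn0 : 0 < tau * n%:R by rewrite mulr_gt0 // ltr0n.
set M := 'C(d + m, d) in binZ.
have term_le j : (eigval A j.+1 / (eigval A j.+1 + tau * n%:R)) <=
    (if (j < M)%N then 1 else (eigenvalues A)`_j / (tau * n%:R)).
  rewrite /eigval /=; have := psd_eigenvalues_ge0 j Apsd.
  set z := _`_j => z0.
  have zt0 : 0 < z + tau * n%:R by rewrite ltr_wpDl.
  case: ifP => _; first by rewrite ler_pdivrMr // mul1r lerDl ltW.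
  by rewrite ler_wpM2l // lef_pV2 ?posrE // lerDr.
(* As [1 <= Z ^+ d], the bound [M + 1] is at most [2 Z^d], within the factor 3. *)
apply: (@le_trans _ _ (M%:R + 1)); last first.
  have : 1 <= Z ^+ d by rewrite exprn_ege1.
  lra.
apply: le_trans (ler_sum _ (fun j _ => term_le j)) _.
have tail_le : \sum_(M <= j < n) (eigenvalues A)`_j / (tau * n%:R) <= 1.
  rewrite -mulr_suml ler_pdivrMr // mul1r mulrC.
  have := sum_gaussian_eigenvalues_tail_le (N := m) (ltW eta0) xr (leqnn _).
  move=> /le_trans; apply.
  by rewrite ler_wpM2l.
have [nM|Mn] := leqP n M.
  rewrite (eq_big_nat _ _ (F2 := fun=> 1)) => [|j /andP[_ jn]]; last first.
    by rewrite (leq_trans jn nM).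
  rewrite sumr_const_nat subn0 ler_wpDr // ler_nat //.
rewrite (@big_cat_nat _ _ _ M) //=; last exact: ltnW.
apply: lerD.
  rewrite (eq_big_nat _ _ (F2 := fun=> 1)) => [|j /andP[_ jn]]; last by rewrite jn.
  by rewrite sumr_const_nat subn0.
apply: le_trans tail_le; rewrite le_eqVlt; apply/orP; left; apply/eqP.
by apply: eq_big_nat => j /andP[Mj _]; rewrite ltnNge Mj.
Qed.

Theorem theorem3 (R : realType) (d n : nat) (rad eta : R)
    (x : 'I_n -> 'rV[R]_d)
    (d_gt0 : (0 < d)%N) (rad_gt0 : 0 < rad) (eta_gt0 : 0 < eta)
    (x_in_ball : forall i : 'I_n, l2norm (x i) <= rad) :
  let K := gaussian_kernel_matrix eta x in
  (forall t : nat, (2 * expR 1) ^+ d <= t%:R :> R ->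
     eigval K t.+1 <=
       n%:R * expR (- (d%:R / (2 * expR 1)) * (t%:R `^ (d%:R^-1)) *
                    ln (d%:R * (t%:R `^ (d%:R^-1)) /
                        (4 * expR 1 ^+ 2 * eta * rad ^+ 2))))
  /\
  (forall tau : R, 0 < tau <= 1 ->
     effective_dim K tau <=
       3 * (6 + 41 / d%:R * eta * rad ^+ 2 + 3 / d%:R * ln (1 / tau)) ^+ d).
Proof.
split=> [t tge|tau tau01]; first exact: gaussian_eigval_le.
exact: gaussian_effective_dim_le.
Qed.
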